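(* There exists an absolute constant $C>0$ such that for infinitely many positive integers $n$ there exists a set $W_n \subseteq \{1,\ldots,n\}$ of square-free integers with the following property: for every function $f: W_n \to \{-1,+1\}$ there exists a positive integer $a$ such that $$\Bigl|\sum_{\substack{b \in W_n\\ a \mid b}} f(b)\Bigr| \;\geq\; n^{1/(C \log\log n)}.$$
   Context: Here $a \mid b$ means that $a$ divides $b$. An integer is square-free if it is not divisible by the square of any prime. The constant $C$ does not depend on $n$, $W_n$, $f$ or $a$. *)

(* Defs.v *)
From mathcomp Require Import all_boot.
Set Implicit Arguments.
Unset Strict Implicit.
Unset Printing Implicit Defensive.

Definition squarefree (b : nat) : Prop :=
  forall p : nat, prime p -> ~~ (p ^ 2 %| b).

(* Main.v *)
(* Take 3t distinct primes, of size t^O(1), arranged in t blocks of three.  For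
   v, w : {0,1,2}^t let a_v be the product of the primes chosen by v, and b_w the
   product of the primes not chosen by w.  Then a_v | b_w iff v and w differ in
   every block, so the divisibility matrix M is the t-th tensor power of J - I
   (3x3), and |det M| = 2^(t 3^(t-1)).

   If every subset of the b_w had a colouring with discrepancy at most D then, by
   the argument of Lovasz, Spencer and Vesztergombi, every integer vector would lie
   within sup-distance D of the lattice spanned by the columns of M.  The box
   [-D, D]^(3^t) would then meet all |det M| cosets of this lattice, forcing
   2^t <= (2D + 1)^3.  So some set of b_w has discrepancy exponential in t, while
   n, the bound for the b_w, is t^O(t), i.e. t is of order log n / log log n.

   The primes come from 2^k <= C(2k, k) <= (2k)^pi(2k). *)
Require Import Defs.
From mathcomp Require Import all_boot all_order all_algebra.
From mathcomp Require Import all_classical all_reals all_analysis.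
From mathcomp Require Import ring lra zify.
Set Implicit Arguments.
Unset Strict Implicit.
Unset Printing Implicit Defensive.
Import Order.TTheory GRing.Theory Num.Theory.
Local Open Scope classical_set_scope.
Local Open Scope ring_scope.

(** * Discrepancy, lattice covering and determinants *)

(* Colouring the odd entries of x with discrepancy at most D makes x even;
   halve and repeat r times. *)
Lemma halving (I : Type) (J : finType) (M : I -> J -> int) (D r : nat)
    (x : J -> int) :
  (forall S : {set J}, exists f : J -> int,
    (forall j, j \in S -> f j = 1 \/ f j = -1) /\
    forall i, `|\sum_(j in S) M i j * f j| <= D%:Z) ->
  exists y : J -> int, forall i,
    `|\sum_j M i j * (x j - 2 ^+ r * y j)| <= D%:Z * (2 ^+ r - 1).
Proof.
move=> disc; elim: r x => [|r IHr] x.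
  exists x => i; rewrite big1 ?normr0 ?subrr ?mulr0 // => j _.
  by rewrite expr0 mul1r subrr mulr0.
pose S := [set j | odd `|x j|%N]%SET.
have [f [f1 fD]] := disc S.
have x2 j : exists z : int, x j = (if j \in S then f j else 0) + 2 * z.
  rewrite inE; case: ifPn => xodd; last by exists (x j %/ 2)%Z; lia.
  have [->|->] : f j = 1 \/ f j = -1 by apply: f1; rewrite inE.
    by exists ((x j - 1) %/ 2)%Z; lia.
  by exists ((x j + 1) %/ 2)%Z; lia.
have [z xz] := choice x2.
have [y yD] := IHr z.
exists y => i.
rewrite (_ : \sum_j _ = \sum_(j in S) M i j * f j +
    2 * \sum_j M i j * (z j - 2 ^+ r * y j)); last first.
  rewrite mulr_sumr [in RHS]big_mkcond -big_split /=; apply: eq_bigr => j _.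
  by rewrite xz exprS; case: ifP => _; ring.
apply: le_trans (ler_normD _ _) _; rewrite normrM (ger0_norm (x := 2)) // exprS.
have := fD i; have := yD i; lra.
Qed.

(* The map e |-> (L e mod d_i)_i kills the columns of M, hence by [cover] it is
   already onto the product of the Z/d_i when e is restricted to the box
   [-D, D]^J. *)
Lemma prod_le_box (J : finType) (M L K N : J -> J -> int) (d : J -> nat)
    (D : nat) :
  (forall v : J -> int, exists y : J -> int, forall i,
    `|v i - \sum_j M i j * y j| <= D%:Z) ->
  (forall i j, \sum_k L i k * K k j = (i == j)%:R) ->
  (forall i j, \sum_k L i k * M k j = (d i)%:Z * N i j) ->
  (forall i, 0 < d i)%N ->
  (\prod_i d i <= (2 * D).+1 ^ #|J|)%N.
Proof.
move=> cover LK LM d_gt0.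
have assoc (B : J -> J -> int) (z : J -> int) i :
    \sum_k L i k * (\sum_j B k j * z j) = \sum_j (\sum_k L i k * B k j) * z j.
  under eq_bigr do rewrite mulr_sumr.
  rewrite exchange_big; apply: eq_bigr => j _; rewrite mulr_suml.
  by apply: eq_bigr => k _; rewrite mulrA.
pose T := {dffun forall i : J, 'I_(d i)}.
have lift (u : T) : exists e : {ffun J -> 'I_(2 * D).+1}, forall i,
    ((\sum_k L i k * ((e k)%:Z - D%:Z))%R = (u i)%:Z %[mod d i])%Z.
  (* [K] inverts [L], so K u is a preimage of the residue vector u. Subtracting the lattice vector M
     y moves it into the box and changes its image only by multiples of the [d i]. *)
  have [y yD] := cover (fun k => \sum_j K k j * (u j)%:Z).
  pose v k := \sum_j K k j * (u j)%:Z - \sum_j M k j * y j.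
  exists [ffun k => inord (absz (v k + D%:Z))] => i.
  have -> : \sum_k L i k * (([ffun k => inord (absz (v k + D%:Z))] k
      : 'I_(2 * D).+1)%:Z - D%:Z) = \sum_k L i k * v k.
    apply: eq_bigr => k _; rewrite ffunE inordK; have := yD k;
      first by move=> /= vD; rewrite -/(v k) in vD; lia.
    by move=> /= vD; rewrite -/(v k) in vD; lia.
  have -> : \sum_k L i k * v k = (u i)%:Z - (\sum_j N i j * y j) * (d i)%:Z.
    under eq_bigr do rewrite mulrBr.
    rewrite sumrB !assoc; congr (_ - _).
      rewrite (bigD1 i) //= LK eqxx mul1r big1 ?addr0 // => j ji.
      by rewrite LK eq_sym (negPf ji) mul0r.
    by rewrite mulr_suml; apply: eq_bigr => j _; rewrite LM; ring.
  by rewrite -mulNr addrC modzMDl.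
have [g gP] := choice lift.
have g_inj : injective g.
  move=> u u' guu'; apply/ffunP => i; apply/val_inj.
  have := gP u' i; rewrite -guu' gP !modz_nat !modn_small //.
  by case.
have := leq_card g g_inj.
rewrite card_ffun card_ord card_dep_ffun.
suff -> : foldr muln 1%N [seq #|'I_(d x)| | x : J] = (\prod_i d i)%N by [].
rewrite foldrE big_map big_enum /=; apply: eq_bigr => i _; exact: card_ord.
Qed.

(** * Tensor powers of integer matrices *)

Definition tens (t m n : nat) (A : 'M[int]_(m, n)) (v : {ffun 'I_t -> 'I_m})
    (w : {ffun 'I_t -> 'I_n}) : int :=
  \prod_i A (v i) (w i).

Lemma tens_mul (t m n p : nat) (A : 'M[int]_(m, n)) (B : 'M[int]_(n, p))
    (v : {ffun 'I_t -> 'I_m}) (w : {ffun 'I_t -> 'I_p}) :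
  \sum_u tens A v u * tens B u w = tens (A *m B) v w.
Proof.
rewrite /tens; under [RHS]eq_bigr do rewrite mxE.
by rewrite bigA_distr_bigA; apply: eq_bigr => u _; rewrite big_split.
Qed.

Lemma tens_scalar (t n : nat) (c : int) (v w : {ffun 'I_t -> 'I_n}) :
  tens c%:M v w = c ^+ t * (v == w)%:R.
Proof.
rewrite /tens; case: (pickP (fun i => v i != w i)) => [i vw|vw].
  rewrite (bigD1 i) //= mxE (negPf vw) mul0r; case: eqP => [vw'|_].
    by rewrite vw' eqxx in vw.
  by rewrite mulr0.
have -> : v = w by apply/ffunP => i; apply/eqP; rewrite -[_ == _]negbK vw.
rewrite eqxx mulr1 (eq_bigr (fun=> c)) ?prodr_const ?card_ord // => i _.
by rewrite mxE eqxx.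
Qed.

(** The indicator of w i = c is a product over coordinates, so the sum over words factors. The
    factor n on the left avoids the exponent t - 1. *)
Lemma card_ffun_eq_at (t n : nat) (i : 'I_t) (c : 'I_n) :
  (n * #|[pred w : {ffun 'I_t -> 'I_n} | w i == c]| = n ^ t)%N.
Proof.
have -> : #|[pred w : {ffun 'I_t -> 'I_n} | w i == c]| =
    (\sum_(w : {ffun 'I_t -> 'I_n}) \prod_k ((k == i) ==> (w k == c)))%N.
  rewrite -sum1_card big_mkcond; apply: eq_bigr => w _.
  rewrite (bigD1 i) //= eqxx big1 ?muln1 => [|k /negPf-> //].
  by rewrite inE /=; case: (w i == c).
rewrite -(bigA_distr_bigA (fun k j => nat_of_bool ((k == i) ==> (j == c)))).
rewrite (bigD1 i) //= eqxx (bigD1 c) //= eqxx big1 => [|j /negPf-> //].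
rewrite addn0 mul1n.
rewrite (eq_bigr (fun=> n)) => [|k /negPf->]; last by rewrite sum1_card card_ord.
by rewrite prod_nat_const cardC1 card_ord -expnS prednK // (leq_trans _ (ltn_ord i)).
Qed.

(** * Discrepancy of the tensor power of J - I *)

Definition offdiag : 'M[int]_3 := \matrix_(i, j) (i != j)%:R.

(** For 3x3 matrices J^2 = 3J, so (J - I)(J - 2I) = 2I. The tensor power of J - 2I is thus the
    integer matrix 2^t M^-1. *)
Lemma offdiag_mul : offdiag *m (const_mx 1 - 2%:M) = 2%:M.
Proof.
apply/matrixP => i j; rewrite !mxE !big_ord_recl big_ord0 !mxE.
by case: i j => [[|[|[|//]]] ?] [[|[|[|//]]] ?].
Qed.

(* [row_sum] is a unimodular change of basis after which the last row of
   [offdiag] is (2, 2, 2), exhibiting the factor det = 2 as a divisor of a row. *)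
Definition row_sum : 'M[int]_3 :=
  \matrix_(i, j) ((i == ord_max) || (i == j))%:R.

Definition row_sum_inv : 'M[int]_3 :=
  \matrix_(i, j) if i == j then 1 else if i == ord_max then -1 else 0.

Definition row_sum_offdiag : 'M[int]_3 :=
  \matrix_(i, j) ((i == ord_max) || (i != j))%:R.

Lemma row_sumK : row_sum *m row_sum_inv = 1%:M.
Proof.
apply/matrixP => i j; rewrite !mxE !big_ord_recl big_ord0 !mxE.
by case: i j => [[|[|[|//]]] ?] [[|[|[|//]]] ?].
Qed.

Lemma row_sum_mul_offdiag i j : (row_sum *m offdiag) i j =
  (if i == ord_max then 2 else 1) * row_sum_offdiag i j.
Proof.
rewrite !mxE !big_ord_recl big_ord0 !mxE.
by case: i j => [[|[|[|//]]] ?] [[|[|[|//]]] ?].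
Qed.

Lemma disc_tens_offdiag (t D : nat) :
  (forall S : {set {ffun 'I_t -> 'I_3}}, exists f : {ffun 'I_t -> 'I_3} -> int,
    (forall w, w \in S -> f w = 1 \/ f w = -1) /\
    forall v : {ffun 'I_t -> 'I_3},
      `|\sum_(w in S | [forall i, v i != w i]) f w| <= D%:Z) ->
  (2 ^ t <= (2 * D).+1 ^ 3)%N.
Proof.
move=> disc.
have tensE (v w : {ffun 'I_t -> 'I_3}) :
    tens offdiag v w = [forall i, v i != w i]%:R.
  rewrite /tens; case: forallP => [vw|/forallP].
    by rewrite big1 // => i _; rewrite mxE vw.
  by rewrite negb_forall => /existsP[i vw]; rewrite (bigD1 i) //= mxE (negPf vw) mul0r.
have cover (v : {ffun 'I_t -> 'I_3} -> int) : exists y : {ffun 'I_t -> 'I_3} -> int,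
    forall i, `|v i - \sum_j tens offdiag i j * y j| <= D%:Z.
  have disc' (S : {set {ffun 'I_t -> 'I_3}}) : exists f : {ffun 'I_t -> 'I_3} -> int,
      (forall w, w \in S -> f w = 1 \/ f w = -1) /\
      forall v : {ffun 'I_t -> 'I_3},
        `|\sum_(w in S) tens offdiag v w * f w| <= D%:Z.
    have [f [f1 fD]] := disc S; exists f; split => // u.
    rewrite (_ : \sum_(w in S) _ =
      \sum_(w in S | [forall i, u i != w i]) f w) // big_mkcondr.
    by apply: eq_bigr => w _; rewrite tensE; case: ifP; rewrite ?mul1r ?mul0r.
  (* Start from 2^t M^-1 v: after t halvings, 2^t v is within D (2^t - 1) of 2^t M y, and dividing
     by 2^t leaves an error of at most D. *)
  have [y yD] := halving t (fun j => \sum_k tens (const_mx 1 - 2%:M) j k * v k) disc'.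
  exists y => i; have := yD i.
  rewrite (_ : \sum_j _ = 2 ^+ t * (v i - \sum_j tens offdiag i j * y j)); last first.
    under eq_bigr do rewrite mulrBr mulr_sumr.
    rewrite sumrB exchange_big /= mulrBr mulr_sumr; congr (_ - _); last first.
      by apply: eq_bigr => j _; ring.
    under eq_bigr do [under eq_bigr do rewrite mulrA];
    under eq_bigr do rewrite -mulr_suml tens_mul offdiag_mul tens_scalar.
    rewrite (bigD1 i) //= eqxx mulr1 big1 ?addr0 // => j ji.
    by rewrite eq_sym (negPf ji) mulr0 mul0r.
  rewrite normrM ger0_norm ?exprn_ge0 // => le_D.
  have p2 : 0 < 2 ^+ t :> int by rewrite exprn_gt0.
  rewrite -(ler_pM2l p2); apply: le_trans le_D _.
  by rewrite mulrBr mulr1 mulrC lerBlDr lerDl.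
(* Row w of the tensor power of [row_sum *m offdiag] carries one factor 2 for each coordinate of w
   equal to [ord_max]. *)
pose d (w : {ffun 'I_t -> 'I_3}) := (\prod_i if w i == ord_max then 2 else 1)%N.
have := @prod_le_box _ (tens offdiag) (tens row_sum) (tens row_sum_inv)
  (tens row_sum_offdiag) d D cover.
have -> : (\prod_w d w = \prod_(i < t)
    2 ^ #|[pred w : {ffun 'I_t -> 'I_3} | w i == ord_max]|)%N.
  rewrite exchange_big; apply: eq_bigr => i _.
  by rewrite -big_mkcond prod_nat_const.
rewrite -expn_sum card_ffun !card_ord => H.
(* Cubing turns the exponent t 3^(t-1) of 2 into t 3^t; then 3^t-th roots are taken. *)
have {H} := H _ _ _; rewrite -(leq_exp2r _ _ (isT : 0 < 3)%N) -!expnM.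
rewrite mulnC big_distrr /=; under eq_bigr do rewrite card_ffun_eq_at.
rewrite sum_nat_const card_ord (mulnC (3 ^ t)%N) !expnM leq_exp2r ?expn_gt0 //.
apply.
- by move=> v w; rewrite tens_mul row_sumK tens_scalar expr1n mul1r.
- move=> v w; rewrite tens_mul /tens (eq_bigr _ (fun i _ => row_sum_mul_offdiag _ _)).
  rewrite big_split /= /d (big_morph Posz PoszM erefl); congr (_ * _).
  by apply: eq_bigr => i _; case: ifP.
- by move=> w; rewrite prodn_gt0 // => i; case: ifP.
Qed.

(** * A Chebyshev-type lower bound for the number of primes *)

(** Legendre's formula with a free cutoff, so that (2k)! and k! can be compared over the same range
    of powers. *)
Lemma logn_fact_trunc (p n N : nat) : prime p -> (n < p ^ N.+1)%N ->
  logn p n`! = (\sum_(1 <= k < N.+1) n %/ p ^ k)%N.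
Proof.
move=> p_pr ltn; rewrite logn_fact //.
have ext M j : (n < p ^ M.+1)%N ->
    (\sum_(1 <= k < (M + j).+1) n %/ p ^ k = \sum_(1 <= k < M.+1) n %/ p ^ k)%N.
  move=> ltM; elim: j => [|j <-]; first by rewrite addn0.
  rewrite addnS big_nat_recr //= divn_small ?addn0 //.
  by apply: leq_trans ltM _; rewrite leq_exp2l ?prime_gt1 // ltnS leq_addr.
by rewrite -(ext N n) // -(ext n N) 1?addnC // ltnW // ltn_expl // prime_gt1.
Qed.

(** In Legendre's formula each power p^i <= 2k contributes floor(2k/p^i) - 2 floor(k/p^i) <= 1, and
    higher powers contribute nothing. *)
Lemma logn_central_bin (p k : nat) : prime p -> (0 < k)%N ->
  (p ^ logn p 'C(2 * k, k) <= 2 * k)%N.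
Proof.
move=> p_pr k_gt0; set e := trunc_log p (2 * k).
have p_gt1 := prime_gt1 p_pr.
have k2_gt0 : (0 < 2 * k)%N by rewrite muln_gt0.
have lt2k : (2 * k < p ^ e.+1)%N by apply: trunc_log_ltn.
apply: leq_trans (trunc_logP p_gt1 k2_gt0).
rewrite leq_exp2l // -/e.
have le_k : (k <= 2 * k)%N by rewrite leq_pmull.
have := congr1 (logn p) (bin_fact le_k).
rewrite (_ : 2 * k - k = k)%N; last by lia.
rewrite !lognM ?muln_gt0 ?fact_gt0 ?bin_gt0 //.
rewrite !(logn_fact_trunc (N := e)) //; last exact: leq_ltn_trans lt2k.
rewrite -big_split /= => eq_sum.
have : (\sum_(1 <= i < e.+1) (2 * k) %/ p ^ i <=
    \sum_(1 <= i < e.+1) (1 + (k %/ p ^ i + k %/ p ^ i)))%N.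
  apply: leq_sum => i _.
  have pi_gt0 : (0 < p ^ i)%N by rewrite expn_gt0 ltnW.
  rewrite -ltnS ltn_divLR //.
  have := divn_eq k (p ^ i); have := ltn_pmod k pi_gt0; nia.
by rewrite big_split /= sum_nat_const_nat -eq_sum leq_add2r subn1 muln1.
Qed.

(** Pascal's rule used twice yields two copies of the previous central coefficient. *)
Lemma leq_expn_central_bin (k : nat) : (2 ^ k <= 'C(2 * k, k))%N.
Proof.
elim: k => // -[_ //|k]; rewrite [(2 ^ k.+2)%N]expnS.
move: (2 * k.+1)%N (mulnS 2 k.+1) => m -> IHk.
by rewrite !add2n !binS; lia.
Qed.

Lemma expn_le_primes (k : nat) : (0 < k)%N ->
  (2 ^ k <= (2 * k) ^ size [seq p <- iota 0 (2 * k).+1 | prime p])%N.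
Proof.
move=> k_gt0; apply: leq_trans (leq_expn_central_bin k) _.
have bin_gt0' : (0 < 'C(2 * k, k))%N by rewrite bin_gt0 leq_pmull.
rewrite {1}(prod_prime_decomp bin_gt0') prime_decompE big_map /=.
apply: leq_trans (_ : (2 * k) ^ size (primes 'C(2 * k, k)) <= _)%N.
  rewrite -iter_muln_1 -count_predT -big_const_seq.
  rewrite big_seq [X in (_ <= X)%N]big_seq.
  by apply: leq_prod => p; rewrite mem_primes => /andP[p_pr _]; apply: logn_central_bin.
rewrite leq_pexp2l ?muln_gt0 //; apply: uniq_leq_size (primes_uniq _) _ => p pC.
have : p \in primes 'C(2 * k, k) by [].
rewrite mem_primes mem_filter mem_iota ltnS => /and3P[p_pr _ p_dvd].
rewrite p_pr prime_gt0 //=; apply: leq_trans (logn_central_bin p_pr k_gt0).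
by rewrite -{1}[p]expn1 leq_exp2l ?prime_gt1 // logn_gt0.
Qed.

Lemma many_primes (u : nat) : exists p : 'I_(2 ^ u) * 'I_3 -> nat,
  [/\ injective p, forall k, prime (p k) & forall k, (p k <= 2 ^ (2 * u + 8))%N].
Proof.
set s := [seq p <- iota 0 (2 ^ (2 * u + 8)).+1 | prime p].
have size_s : (2 ^ u * 3 <= size s)%N.
  have := @expn_le_primes (2 ^ (2 * u + 7)) _; rewrite expn_gt0 => /(_ isT).
  rewrite -expnS -addnS -/s -expnM leq_exp2l // expnD => le_s.
  have lt_u : (u < 2 ^ u)%N by apply: ltn_expl.
  rewrite leqNgt; apply/negP => lts.
  (* With t = 2^u, fewer than 3t primes would give 128 t^2 <= 8t * 3t = 24 t^2. *)
  have : ((2 * u + 8) * size s <= (2 ^ u * 8) * (2 ^ u * 3))%N by apply: leq_mul; lia.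
  have : (0 < 2 ^ u * 2 ^ u)%N by rewrite muln_gt0 expn_gt0.
  move: le_s; rewrite mul2n -addnn expnD; lia.
pose p (k : 'I_(2 ^ u) * 'I_3) := nth 0%N s (k.1 * 3 + k.2).
have lt_size (k : 'I_(2 ^ u) * 'I_3) : (k.1 * 3 + k.2 < size s)%N.
  apply: leq_trans size_s; have := ltn_ord k.1; have := ltn_ord k.2; lia.
have p_s k : p k \in s by apply: mem_nth.
exists p; split=> [k k' /eqP|k|k].
- rewrite nth_uniq ?filter_uniq ?iota_uniq // => /eqP.
  case: k k' => [i j] [i' j'] /= eqk; congr (_, _); apply/val_inj => /=;
    have := ltn_ord j; have := ltn_ord j'; lia.
- by have := p_s k; rewrite mem_filter => /andP[].
- by have := p_s k; rewrite mem_filter mem_iota ltnS => /andP[].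
Qed.

(** * From words to square-free integers *)

Lemma prime_dvd_prod_primes (K : finType) (p : K -> nat) (q : nat) (P : pred K) :
  (forall k, prime (p k)) -> prime q -> (q %| \prod_(k | P k) p k)%N ->
  exists2 k, P k & q = p k.
Proof.
move=> p_pr q_pr; rewrite Euclid_dvd_prod // big_has_cond => /hasP[k _ /andP[Pk]].
by rewrite dvdn_prime2 // => /eqP ->; exists k.
Qed.

Lemma dvdn_prod_primes (K : finType) (p : K -> nat) (k : K) (P : pred K) :
  injective p -> (forall k, prime (p k)) ->
  (p k %| \prod_(l | P l) p l)%N = P k.
Proof.
move=> p_inj p_pr; apply/idP/idP => [|Pk].
  by move=> /(prime_dvd_prod_primes p_pr (p_pr k))[l Pl /p_inj->].
by rewrite (bigD1 k) //= dvdn_mulr.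
Qed.

Lemma squarefree_prod_primes (K : finType) (p : K -> nat) (P : pred K) :
  injective p -> (forall k, prime (p k)) -> squarefree (\prod_(k | P k) p k).
Proof.
move=> p_inj p_pr q q_pr; apply/negP => q2_dvd.
have q_dvd : (q %| \prod_(k | P k) p k)%N by apply: dvdn_trans q2_dvd; apply: dvdn_exp.
have [k Pk qE] := prime_dvd_prod_primes p_pr q_pr q_dvd.
move: q2_dvd; rewrite (bigD1 k) //= qE expnS expn1 dvdn_pmul2l ?prime_gt0 //.
by rewrite dvdn_prod_primes // eqxx andbF.
Qed.

Lemma large_disc_multiples (t D X n : nat) (p : 'I_t * 'I_3 -> nat) :
  injective p -> (forall k, prime (p k)) -> (forall k, p k <= X)%N ->
  (X ^ (t * 3) <= n)%N -> ((2 * D).+1 ^ 3 < 2 ^ t)%N ->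
  exists W : {set 'I_n.+1},
    (forall b : 'I_n.+1, b \in W -> (0 < b)%N /\ squarefree b) /\
    forall f : nat -> int,
      (forall b : 'I_n.+1, b \in W -> f b = 1 \/ f b = -1) ->
      exists a : nat, (0 < a)%N /\
        D%:Z < `|\sum_(b in W | (a %| b)%N) f b|.
Proof.
move=> p_inj p_pr p_le Xn DT.
pose A (v : {ffun 'I_t -> 'I_3}) := (\prod_i p (i, v i))%N.
pose B (w : {ffun 'I_t -> 'I_3}) := (\prod_(k | k.2 != w k.1) p k)%N.
have A_gt0 v : (0 < A v)%N by apply: prodn_gt0 => i; apply: prime_gt0.
have dvdAB v w : (A v %| B w)%N = [forall i, v i != w i].
  apply/idP/forallP => [AB i|vw].
    have : (p (i, v i) %| B w)%N.
      by apply: dvdn_trans AB; rewrite /A (bigD1 i) //= dvdn_mulr.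
    by rewrite dvdn_prod_primes //.
  (* Grouped by blocks, factor i of [A v] divides block i of [B w]. *)
  have -> : B w = (\prod_i \prod_(j | j != w i) p (i, j))%N.
    by rewrite pair_big_dep; apply: eq_big => -[].
  apply: (big_ind2 (fun x y => x %| y)%N) => // [x1 x2 y1 y2|i _].
    exact: dvdn_mul.
  by rewrite (bigD1 (v i)) //= dvdn_mulr.
have B_inj : injective B.
  move=> v w eqB; apply/ffunP => i; apply/eqP; apply: contraT => vw.
  have : (p (i, v i) %| B w)%N by rewrite dvdn_prod_primes //.
  by rewrite -eqB dvdn_prod_primes //= eqxx.
have B_le w : (B w <= n)%N.
  apply: leq_trans Xn; have -> : (t * 3)%N = #|{: 'I_t * 'I_3}|.
    by rewrite card_prod !card_ord.
  rewrite -prod_nat_const /B big_mkcond; apply: leq_prod => k _.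
  by case: ifP => // _; apply: leq_trans (p_le k); apply: prime_gt0.
pose b w : 'I_n.+1 := inord (B w).
have bE w : b w = B w :> nat by rewrite inordK // ltnS.
have b_inj : injective b.
  by move=> v w eqb; apply: B_inj; rewrite -!bE eqb.
(* If no W works, the image of each S under [b] has a colouring with all sums at most D; testing it
   at a = [A v] gives the hypothesis of [disc_tens_offdiag]. *)
apply: contrapT => noW.
suff /disc_tens_offdiag : forall S : {set {ffun 'I_t -> 'I_3}},
    exists f : {ffun 'I_t -> 'I_3} -> int,
      (forall w, w \in S -> f w = 1 \/ f w = -1) /\
      forall v : {ffun 'I_t -> 'I_3},
        `|\sum_(w in S | [forall i, v i != w i]) f w| <= D%:Z.
  by rewrite leqNgt DT.
move=> S; apply: contrapT => noF; apply: noW.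
exists [set b w | w in S]%SET; split.
  move=> _ /imsetP[w _ ->]; rewrite bE; split.
    by apply: prodn_cond_gt0 => k _; apply: prime_gt0.
  exact: squarefree_prod_primes.
move=> f f1; apply: contrapT => noA; apply: noF.
exists (fun w => f (b w)); split=> [w wS|v].
  by apply: f1; apply: imset_f.
rewrite leNgt; apply/negP => ltD; apply: noA; exists (A v); split => //.
rewrite big_mkcondr big_imset /=; last by move=> ? ? _ _; apply: b_inj.
rewrite -big_mkcondr /= (eq_bigl (fun w => (w \in S) && [forall i, v i != w i])) //.
by move=> w; rewrite bE dvdAB.
Qed.

(** * Choice of parameters and conclusion *)

(** With x = 2^v, ln n = x ln 2 (96u + 384), and ln ln n >= u ln 2 >= u/2. The claim reduces to 96u
    + 384 <= 192u, which holds since u >= 4; hence the constant 192. *)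
Lemma powR_bound (R : realType) (u v n : nat) :
  u = (v + 4)%N -> n = ((2 ^ (2 * u + 8)) ^ (2 ^ u * 3))%N ->
  n%:R `^ (1 / (192 * ln (ln n%:R))) <= (2 ^ 2 ^ v.+1)%:R :> R.
Proof.
move=> uE nE.
set l : R := ln 2.
have l_ge : 1 / 2 <= l.
  have := @le_ln1Dx R (- (1 / 2)) _; rewrite (_ : 1 + - (1 / 2) = 2^-1); last by lra.
  by rewrite lnV ?posrE // -/l => H; have := H ltac:(lra); lra.
have n_gt0 : 0 < n%:R :> R by rewrite ltr0n nE !expn_gt0.
pose x : R := (2 ^ v)%:R.
have x_gt0 : 0 < x by rewrite ltr0n expn_gt0.
have lnn : ln n%:R = (2 * u%:R + 8) * (48 * x) * l :> R.
  rewrite nE -expnM natrX lnXn // -/l -[l *+ _]mulr_natl natrM natrD natrM.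
  rewrite uE /x expnD !natrM; ring.
have u_ge4 : 4 <= u%:R :> R by rewrite ler_nat uE leq_addl.
have lnln : u%:R * l <= ln (ln n%:R).
  rewrite mulr_natl -lnXn // ler_ln ?posrE ?exprn_gt0 //; last first.
    by rewrite lnn !mulr_gt0 //; lra.
  rewrite lnn uE exprD (_ : 2 ^+ v = x); last by rewrite /x natrX.
  have : x * 8 <= x * ((2 * (v + 4)%:R + 8) * l) by rewrite ler_pM2l // -uE; nra.
  lra.
have ul_gt0 : 0 < u%:R * l by nra.
rewrite /powR; case: eqVneq => [n0|_]; first by rewrite n0 ltxx in n_gt0.
rewrite -[leRHS]lnK ?posrE ?ltr0n ?expn_gt0 // ler_expR.
rewrite natrX lnXn // -/l -[l *+ _]mulr_natl.
rewrite mul1r mulrC ler_pdivrMr; last by nra.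
rewrite [leLHS]lnn expnS natrM -/x.
have : 2 * x * l * (192 * (u%:R * l)) <= 2 * x * l * (192 * ln (ln n%:R)).
  by rewrite ler_pM2l ?mulr_gt0 //; lra.
move=> /(le_trans _); apply.
have -> : (2 * u%:R + 8) * (48 * x) * l = (x * l) * (96 * u%:R + 384) by ring.
have -> : 2 * x * l * (192 * (u%:R * l)) = (x * l) * (384 * (u%:R * l)) by ring.
by rewrite ler_pM2l ?mulr_gt0 //; nra.
Qed.

Theorem theorem1p2 (R : realType) :
  exists C : R, 0 < C /\
  infinite_set [set n : nat | (0 < n)%N /\
    exists W : {set 'I_n.+1},
      (forall b : 'I_n.+1, b \in W -> (0 < b)%N /\ squarefree b) /\
      forall f : nat -> int,
        (forall b : 'I_n.+1, b \in W -> f b = 1 \/ f b = -1) ->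
        exists a : nat, (0 < a)%N /\
          `|\sum_(b in W | (a %| b)%N) f b|%:~R
             >= n%:R `^ (1 / (C * ln (ln n%:R))) :> R].
Proof.
exists 192; split => // /finite_seqP[s sE].
(* Exceeding the sum of the supposed finite list forces n > v to lie outside it. *)
pose v := (\sum_(m <- s) m).+1.
pose u := (v + 4)%N.
pose n := ((2 ^ (2 * u + 8)) ^ (2 ^ u * 3))%N.
have n_s : n \notin s.
  apply/negP => ns; have : (n <= \sum_(m <- s) m)%N by rewrite (big_rem n) //= leq_addr.
  apply/negP; rewrite -ltnNge /n -expnM.
  apply: leq_trans (ltnW (ltn_expl _ (isT : 1 < 2)%N)).
  apply: leq_trans (leq_pmulr _ _); last by rewrite muln_gt0 expn_gt0.
  by rewrite -/v /u; lia.
(* Here t = 2^u and D = 2^(t/8): 2D + 1 < 4D and 3(t/8 + 2) <= t. *)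
have disc_lt : ((2 * 2 ^ 2 ^ v.+1).+1 ^ 3 < 2 ^ 2 ^ u)%N.
  have -> : (2 ^ u = 8 * 2 ^ v.+1)%N by rewrite /u addnC !expnS; lia.
  have e_ge2 : (2 <= 2 ^ v.+1)%N by rewrite expnS leq_pmulr ?expn_gt0.
  apply: (@leq_trans (2 ^ ((2 ^ v.+1 + 2) * 3))); last by rewrite leq_exp2l //; lia.
  rewrite [X in (_ < X)%N]expnM ltn_exp2r // expnD.
  have : (0 < 2 ^ 2 ^ v.+1)%N by rewrite expn_gt0.
  lia.
have : [set` s] n.
  rewrite -sE /=; split; first by rewrite !expn_gt0.
  have [p [p_inj p_pr p_le]] := many_primes u.
  have [W [W_sqf discW]] :=
    large_disc_multiples p_inj p_pr p_le (leqnn n) disc_lt.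
  exists W; split => // f /discW[a [a_gt0 lt_a]]; exists a; split => //.
  apply: le_trans (powR_bound R (erefl u) (erefl n)) _.
  by rewrite -[(2 ^ _)%:R]/((2 ^ 2 ^ v.+1)%:Z%:~R) ler_int ltW.
by rewrite /= (negPf n_s).
Qed.
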